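(* Let $p\in(0,1]$ be a rational number. For each positive integer $N$ such that $K=pN$ is an integer, let $X_N$ be the number of draws up to and including the first good object when objects are drawn one at a time, uniformly at random and without replacement, from an urn containing $N$ objects of which exactly $K=pN$ are good. Let $Y$ be the number of draws up to and including the first good object when draws are made with replacement from an urn with proportion $p$ of good objects. Then $X_N$ converges in distribution to $Y$ as $N\to\infty$ (along those $N$ with $pN$ an integer, so that $K/N=p$ is held fixed).
   Context: The probability mass function of $X_N$ is $\Pr(X_N=n)=\frac{\binom{N-n+1}{K}}{\binom{N}{K}}\cdot\frac{K}{N-n+1}$ for $n=1,2,\ldots,N-K+1$, and $0$ otherwise, where $K=pN$. The variable $Y$ is geometric on $\{1,2,3,\ldots\}$: $\Pr(Y=n)=(1-p)^{n-1}p$ for $n\ge 1$ (with $0^0=1$). *)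

(* Defs.v *)
From HB Require Import structures.
From mathcomp Require Import all_boot all_order all_algebra.
From mathcomp Require Import all_classical all_reals all_analysis.

Set Implicit Arguments.
Unset Strict Implicit.
Unset Printing Implicit Defensive.

Import Order.TTheory GRing.Theory Num.Theory.
Import numFieldNormedType.Exports.

Local Open Scope classical_set_scope.
Local Open Scope ring_scope.

(* Convergence of X_N to Y along the filter F, at the continuity points of the
   limit distribution function.  The X_N and Y may all live on different
   probability spaces. *)
Definition cvg_in_distribution (R : realType) (F : set_system nat)
    (d : nat -> measure_display) (T : forall N, measurableType (d N))
    (P : forall N, probability (T N) R) (X : forall N, {RV (P N) >-> R})
    (d' : measure_display) (T' : measurableType d') (P' : probability T' R)
    (Y : {RV P' >-> R}) : Prop :=
  forall x : R, {for x, continuous (cdf Y)} ->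
    cdf (X N) x @[N --> F] --> cdf Y x.

(* Draws are numbered from 0: D i w is the (i+1)-st object drawn. *)

Definition drawn (T V : Type) (D : nat -> T -> V) (s : seq V) : set T :=
  [set w | [seq D i w | i <- iota 0 (size s)] = s].

(* urn s is the content of the urn once the objects in s have been drawn.
   Given any past s that leaves the urn nonempty, the next draw is uniform on
   urn s; the conditional probability is multiplied out so that nothing is
   required of pasts of probability 0. Draws from an empty urn are
   unconstrained. *)
Definition uniform_draws (R : realType) (d : measure_display)
    (T : measurableType d) (P : probability T R) (V : finType)
    (urn : seq V -> {set V}) (D : nat -> T -> V) : Prop :=
  (forall i v, measurable [set w | D i w = v]) /\
  (forall (s : seq V) (v : V), urn s != finset.set0 ->
     P (drawn D (rcons s v)) =
     (P (drawn D s) *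
      (if v \in urn s then (#|urn s|%:R^-1 : R) else 0)%:E)%E).

Definition without_replacement (V : finType) (s : seq V) : {set V} :=
  [set v | v \notin s]%SET.

Definition with_replacement (V : finType) (s : seq V) : {set V} :=
  [set: V]%SET.

Definition first_good_at (T : Type) (V : finType) (G : {set V})
    (D : nat -> T -> V) (w : T) (i : nat) : Prop :=
  D i w \in G /\ forall j, (j < i)%N -> D j w \notin G.

(* X is the number of draws up to and including the first object of G. Its
   value is left arbitrary on the outcomes where no object of G is ever drawn
   (these have probability 0 as soon as G is nonempty). *)
Definition draws_to_first_good (R : realType) (d : measure_display)
    (T : measurableType d) (P : probability T R) (V : finType)
    (urn : seq V -> {set V}) (G : {set V}) (X : {RV P >-> R}) : Prop :=
  exists2 D : nat -> T -> V, uniform_draws P urn D &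
    forall w i, first_good_at G D w i -> X w = i.+1%:R.

Definition admissible (p : rat) : set nat :=
  [set N | (0 < N)%N /\ p * N%:R \is a Num.int].

(* Main.v *)
Require Import Defs.
From HB Require Import structures.
From mathcomp Require Import all_boot all_order all_algebra.
From mathcomp Require Import all_classical all_reals all_analysis.
From mathcomp Require Import ring lra zify.

Set Implicit Arguments.
Unset Strict Implicit.
Unset Printing Implicit Defensive.

Import Order.TTheory GRing.Theory Num.Theory.
Import numFieldNormedType.Exports.

Local Open Scope classical_set_scope.
Local Open Scope ring_scope.

(** Both urns have the property that, as long as no good object has come up,
the probability that the next draw is again bad depends only on the number j of
draws already made: call it r j.  Conditioning on the next draw, object by
object, the probability that the first k draws are all bad is then the product
of the r j for j < k ([prob_avoids_after]).  Without replacement,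
r j = (N - K - j) / (N - j); with replacement, r j = 1 - p.

In both cases this product tends to 0 as k grows, so that a good object is
almost surely drawn, and for the natural number n such that i + 1 <= x exactly
when i < n, the event X <= x is, up to a null set, the event that the first n
draws are not all bad ([cdf_draws_to_first_good]).  Thus the two distribution
functions at x are 1 - \prod_(j < n) r j.  For fixed n this is a product of a
fixed number of factors, and for each fixed j the factor (N - K - j) / (N - j)
differs from (N - K) / N = 1 - p by at most 2 j / N ([ratio_dist_le]), hence
tends to 1 - p. *)

(** * Runs of bad draws after a given past *)

(** The past s is kept as a parameter because the probability of a bad run is
computed by induction on its length, lengthening s by one draw at each step. *)
Definition avoids_after (T : Type) (V : finType) (D : nat -> T -> V)
    (G : {set V}) (s : seq V) (k : nat) : set T :=
  drawn D s `&` [set w | forall j, (j < k)%N -> D (size s + j)%N w \notin G].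

Lemma drawn_nil (T V : Type) (D : nat -> T -> V) : drawn D [::] = setT.
Proof. by apply/seteqP; split. Qed.

Lemma drawn_rcons (T : Type) (V : eqType) (D : nat -> T -> V) (s : seq V)
    (v : V) :
  drawn D (rcons s v) = drawn D s `&` [set w | D (size s) w = v].
Proof.
apply/seteqP; split => w; rewrite /drawn /= size_rcons -addn1 iotaD map_cat cats1.
  by move=> /rcons_inj[-> ->].
by move=> [-> ->].
Qed.

Section measurability.
Variables (d : measure_display) (T : measurableType d) (V : finType).
Variables (D : nat -> T -> V).
Hypothesis mD : forall i v, measurable [set w | D i w = v].

Lemma measurable_drawn (s : seq V) : measurable (drawn D s).
Proof.
elim/last_ind: s => [|s v IH]; first by rewrite drawn_nil.
by rewrite drawn_rcons; apply: measurableI.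
Qed.

Lemma measurable_avoid (G : {set V}) i : measurable [set w | D i w \notin G].
Proof.
have -> : [set w | D i w \notin G] =
    \bigcup_(v in [set v | v \notin G]) [set w | D i w = v].
  by apply/seteqP; split => [w /= wG|w [v /= vG wv]]; [exists (D i w)|rewrite wv].
exact: fin_bigcup_measurable.
Qed.

Lemma measurable_avoids_after (G : {set V}) (s : seq V) k :
  measurable (avoids_after D G s k).
Proof.
apply: measurableI; first exact: measurable_drawn.
have -> : [set w | forall j, (j < k)%N -> D (size s + j)%N w \notin G] =
    \bigcap_(j in [set j | (j < k)%N]) [set w | D (size s + j)%N w \notin G].
  by apply/seteqP; split.
apply: fin_bigcap_measurable => [|j _]; first exact: finite_II.
exact: measurable_avoid.
Qed.

End measurability.

(** * The probability of a bad run *)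

Lemma measure_fin_partition (R : realType) (d : measure_display)
    (T : measurableType d) (mu : {measure set T -> \bar R}) (V : finType)
    (f : T -> V) (A : set T) :
  measurable A -> (forall v, measurable [set w | f w = v]) ->
  mu A = (\sum_(v : V) mu (A `&` [set w | f w = v]))%E.
Proof.
move=> mA mf.
rewrite -big_enum fsbig_seq ?enum_uniq// -measure_fin_bigcup//; last first.
- by move=> v _; apply: measurableI.
- by move=> v v' _ _ [w [[_ /= <-] [_ /= <-]]].
congr (mu _); apply/seteqP; split => [w Aw|w [v _ []]//].
by exists (f w) => //=; rewrite mem_enum.
Qed.

Section survival.
Variables (R : realType) (d : measure_display) (T : measurableType d).
Variables (P : probability T R) (V : finType) (urn : seq V -> {set V}).
Variables (D : nat -> T -> V) (G : {set V}).
Hypothesis hD : uniform_draws P urn D.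

Lemma avoids_afterS (s : seq V) k v : v \notin G ->
  avoids_after D G s k.+1 `&` [set w | D (size s) w = v] =
  avoids_after D G (rcons s v) k.
Proof.
move=> vG; rewrite /avoids_after drawn_rcons size_rcons.
apply/seteqP; split => w /=.
  move=> [[sw Gw] vw]; split => // j jk.
  by rewrite addSnnS; apply: Gw.
move=> [[sw vw] Gw]; do 2!split => //.
case=> [|j] jk; first by rewrite addn0 vw.
by rewrite -addSnnS; apply: Gw.
Qed.

(** The chain rule.  Any [valid] past extended by a bad object of its urn must be
valid again, so that [valid] covers all the pasts that can arise in a bad run;
the proportion of bad objects in the urn is a function of the number of draws
for those pasts, but not for arbitrary ones.  The events
where the next draw v is good are empty, those where v is not in the urn are
null, and each of the #|urn s :\: G| remaining ones contributes the same
product by induction. *)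
Lemma prob_avoids_after (valid : seq V -> Prop) (r : nat -> R) :
  (forall s, valid s -> urn s != finset.set0) ->
  (forall s v, valid s -> v \in urn s -> v \notin G -> valid (rcons s v)) ->
  (forall s, valid s -> #|urn s :\: G|%:R / #|urn s|%:R = r (size s)) ->
  forall k s, valid s ->
    P (avoids_after D G s k) =
    (P (drawn D s) * (\prod_(j < k) r (size s + j)%N)%:E)%E.
Proof.
move=> urn0 validS rE; have [mD PD] := hD.
elim=> [|k IH] s vs.
  rewrite big_ord0 mule1; congr (P _).
  by apply/seteqP; split => [w []|w].
rewrite (measure_fin_partition P (measurable_avoids_after mD G s k.+1)
  (mD (size s))).
have term v : P (avoids_after D G s k.+1 `&` [set w | D (size s) w = v]) =
    ((if v \in urn s :\: G then
       fine (P (drawn D s)) * #|urn s|%:R^-1 *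
       \prod_(j < k) r ((size s).+1 + j)%N else 0) : R)%:E.
  have fP : (P (drawn D s) \is a fin_num).
    by rewrite fin_num_measure//; apply: measurable_drawn.
  rewrite inE; have [vG|vG] /= := boolP (v \in G).
    (* The run imposes a condition on its own first draw, j = 0. *)
    rewrite (_ : _ `&` _ = set0) ?measure0//; apply/seteqP; split => // w /=.
    by move=> [[_ /(_ 0%N isT)]]; rewrite addn0 => /[swap] ->; rewrite vG.
  rewrite avoids_afterS//.
  have := PD s v (urn0 _ vs); case: ifPn => [vu Pv|vu].
    by rewrite IH ?Pv ?size_rcons; [rewrite !EFinM fineK|exact: validS].
  rewrite mule0 => Pv; apply: (subset_measure0 _ _ _ Pv).
  - exact: measurable_avoids_after.
  - exact: measurable_drawn.
  - by move=> w [].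
rewrite (eq_bigr _ (fun v _ => term v)) sumEFin -big_mkcond /= sumr_const.
rewrite big_ord_recl addn0 -rE// -[P (drawn D s) in RHS]fineK; last first.
  by rewrite fin_num_measure//; apply: measurable_drawn.
rewrite -EFinM; congr (_%:E); rewrite -[LHS]mulr_natl.
under [in RHS]eq_bigr do rewrite addnS -addSn.
by rewrite /= !mulrA; congr (_ / _ * _); exact: mulrC.
Qed.

(** The value of X is arbitrary on the event [never] that all draws are bad, but
[never] lies in every finite bad run, so it is null as soon as the run
probabilities tend to 0.  Off [never], X <= x holds exactly when a good object
comes up among the first truncn x draws; truncn x = 0 for x < 1, negative x
included, which is the right count there. *)
Lemma cdf_draws_to_first_good (X : {RV P >-> R}) (q : nat -> R) :
  (forall w i, first_good_at G D w i -> X w = i.+1%:R) ->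
  (forall k, P (avoids_after D G [::] k) = (q k)%:E) ->
  q k @[k --> \oo] --> 0 ->
  forall x, cdf X x = (1 - q (Num.truncn x))%:E.
Proof.
move=> XE qE q0 x; have [mD _] := hD.
set n := Num.truncn x.
have mB k := measurable_avoids_after mD G [::] k.
pose never := \bigcap_k avoids_after D G [::] k.
have mnever : measurable never by exact: bigcap_measurable.
have Pnever : P never = 0%E.
  apply/eqP; rewrite eq_le measure_ge0 andbT.
  apply/lee_addgt0Pr => e e0; rewrite add0e.
  have /cvgr0Pnorm_lt/(_ e e0)[m _ /(_ m (leqnn m)) /= qm] := q0.
  apply: (@le_trans _ _ (q m)%:E); last first.
    by rewrite lee_fin (le_trans (ler_norm _))// ltW.
  by rewrite -qE; apply: le_measure; rewrite ?inE// => w; apply.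
have first w k : ~ avoids_after D G [::] k w ->
    exists2 i, (i < k)%N & first_good_at G D w i.
  move=> nw.
  have ex : exists i, (i < k)%N && (D i w \in G).
    apply: contrapT => /forallNP H; apply: nw; split => //= j jk.
    by apply/negP => jG; apply: (H j); rewrite jk.
  case: (ex_minnP ex) => i /andP[ik iG] imin; exists i => //; split => // j ji.
  apply/negP => jG; have := imin j; rewrite jG (ltn_trans ji ik) => /(_ isT).
  by rewrite leqNgt ji.
have mX : measurable [set w | X w <= x].
  have := measurable_funPTI X (measurable_itv `]-oo, x]).
  by congr (measurable _); apply/seteqP; split => w /=; rewrite in_itv.
have -> : cdf X x = P [set w | X w <= x].
  by congr (P _); apply/seteqP; split => w /=; rewrite in_itv.
have -> : (1 - q n)%:E = P (~` avoids_after D G [::] n).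
  by rewrite probability_setC// qE.
apply/eqP; rewrite eq_le; apply/andP; split; last first.
  apply: le_measure; rewrite ?inE//; first exact: measurableC.
  move=> w /first[i ilt wi] /=; rewrite (XE _ _ wi).
  by rewrite -truncn_gt_nat.
rewrite -(measureU0 (measurableC (mB n)) mnever Pnever).
apply: le_measure; rewrite ?inE//.
  by apply: measurableU => //; exact: measurableC.
move=> w /= Xw; have [wn|/existsNP[k /not_implyP[_ wk]]] :=
  pselect (never w); [by right|left => wn].
have [i ik wi] := first _ _ wk.
move: Xw; rewrite (XE _ _ wi) -truncn_gt_nat -/n => lt_in.
by case: wn => _ /(_ i lt_in); case: wi => /= ->.
Qed.

End survival.

(** * The two urns *)

(** Here a past is valid when it has no repetition and contains no good object.
Such a past leaves every good object in the urn, which is therefore nonempty;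
this makes the formula hold for all k, with truncated subtractions, since the
factor j = #|V| - #|G| is already 0. *)
Lemma prob_avoids_without (R : realType) (d : measure_display)
    (T : measurableType d) (P : probability T R) (V : finType) (G : {set V})
    (D : nat -> T -> V) (k : nat) :
  (0 < #|G|)%N -> uniform_draws P (@without_replacement V) D ->
  P (avoids_after D G [::] k) =
  (\prod_(j < k) ((#|V| - #|G| - j)%:R / (#|V| - j)%:R))%:E.
Proof.
move=> G0 hD.
pose valid (s : seq V) : Prop := uniq s /\ forall v, v \in s -> v \notin G.
have urnE s : without_replacement s = (~: [set v in s])%SET.
  by apply/setP => v; rewrite !inE.
have cardC (A : {set V}) : #|(~: A)%SET| = (#|V| - #|A|)%N.
  by rewrite cardsCs finset.setCK.
have card_seq s : valid s -> #|[set v in s]%SET| = size s.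
  by move=> [us _]; rewrite cardsE; apply/card_uniqP.
rewrite (prob_avoids_after hD (valid := valid)
  (r := fun j => (#|V| - #|G| - j)%:R / (#|V| - j)%:R)) //.
- by rewrite drawn_nil probability_setT mul1e.
- move=> s [_ sG]; have /card_gt0P[v vG] := G0.
  apply/set0Pn; exists v; rewrite inE.
  by apply/negP => /sG; rewrite vG.
- move=> s v [us sG]; rewrite inE => vs vG; split.
    by rewrite rcons_uniq vs.
  by move=> u; rewrite mem_rcons inE => /orP[/eqP->|/sG].
- move=> s vs; have [_ sG] := vs.
  rewrite urnE finset.setDE -finset.setCU !cardC.
  rewrite cardsU card_seq// (_ : _ :&: G = finset.set0)%SET; last first.
    by apply/setP => v; rewrite !inE; apply/negP => /andP[/sG/negP].
  by rewrite cards0 subn0 addnC subnDA.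
Qed.

Lemma prob_avoids_with (R : realType) (d : measure_display)
    (T : measurableType d) (P : probability T R) (V : finType) (G : {set V})
    (D : nat -> T -> V) (k : nat) :
  (0 < #|V|)%N -> uniform_draws P (@with_replacement V) D ->
  P (avoids_after D G [::] k) = (((#|V| - #|G|)%:R / #|V|%:R) ^+ k)%:E.
Proof.
move=> V0 hD.
rewrite (prob_avoids_after hD (valid := fun=> True)
  (r := fun=> (#|V| - #|G|)%:R / #|V|%:R)) //.
- by rewrite drawn_nil probability_setT mul1e prodr_const card_ord.
- move=> s _; have /card_gt0P[v _] := V0.
  by apply/set0Pn; exists v; rewrite inE.
- by move=> s _; rewrite finset.setTD cardsT cardsCs finset.setCK.
Qed.

(** * The limit *)

(** With a = N - K, the difference is - j (N - a) / ((N - j) N) when j <= a, and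
N - a <= N <= 2 (N - j); when a < j the truncated numerator vanishes and the
difference is - a / N. *)
Lemma ratio_dist_le (R : realFieldType) (N K j : nat) :
  (K <= N)%N -> (2 * j < N)%N ->
  `|(N - K - j)%:R / (N - j)%:R - (N - K)%:R / N%:R| <= 2 * j%:R / N%:R :> R.
Proof.
move=> KN jN.
have [a aE] : exists a, a = (N - K)%N by exists (N - K)%N.
have aN : a%:R <= N%:R :> R by rewrite ler_nat aE leq_subr.
have N0 : 0 < N%:R :> R by rewrite ltr0n; lia.
have jN' : 2 * j%:R < N%:R :> R by rewrite -natrM ltr_nat.
have j0 : 0 <= j%:R :> R by rewrite ler0n.
have a0 : 0 <= a%:R :> R by rewrite ler0n.
rewrite -aE [(N - j)%:R]natrB; last by lia.
have Nj0 : 0 < N%:R - j%:R :> R by lra.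
have [ja|aj] := leqP j a.
  rewrite natrB//.
  have -> : (a%:R - j%:R) / (N%:R - j%:R) - a%:R / N%:R =
      - (j%:R * (N%:R - a%:R) / (N%:R - j%:R) / N%:R) :> R.
    by field; rewrite !lt0r_neq0.
  rewrite normrN ger0_norm; last first.
    by rewrite !divr_ge0 ?mulr_ge0 ?(ltW N0) ?(ltW Nj0) ?subr_ge0.
  rewrite ler_pM2r ?invr_gt0// ler_pdivrMr//.
  nra.
rewrite (_ : (a - j)%N = 0%N); last by lia.
rewrite mul0r sub0r normrN ger0_norm ?divr_ge0 ?(ltW N0)//.
rewrite ler_pM2r ?invr_gt0//.
have : a%:R <= j%:R :> R by rewrite ler_nat ltnW.
lra.
Qed.

Theorem theorem2p9 (R : realType) (p : rat) (p_gt0 : 0 < p) (p_le1 : p <= 1)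
    (d : nat -> measure_display) (T : forall N, measurableType (d N))
    (P : forall N, probability (T N) R) (X : forall N, {RV (P N) >-> R})
    (hX : forall N, admissible p N ->
       exists2 G : {set 'I_N}, #|G|%:R = p * N%:R &
         draws_to_first_good (@without_replacement 'I_N) G (X N))
    (d' : measure_display) (T' : measurableType d') (P' : probability T' R)
    (V : finType) (G : {set V}) (hG : #|G|%:R / #|V|%:R = p)
    (Y : {RV P' >-> R})
    (hY : draws_to_first_good (@with_replacement V) G Y) :
  cvg_in_distribution (within (admissible p) \oo) X Y.
Proof.
move=> x _; set n := Num.truncn x.
pose q : R := ratr (1 - p).
have q_lt1 : `|q| < 1.
  rewrite ger0_norm /q; last by rewrite ler0q subr_ge0.
  by rewrite -[ltRHS](ratr_nat R 1) ltr_rat ltrBlDr ltrDl.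
have cdfY : cdf Y x = (1 - q ^+ n)%:E.
  have V0 : (0 < #|V|)%N.
    rewrite lt0n; apply: contraTneq p_gt0 => V0.
    by rewrite -hG V0 invr0 mulr0 ltxx.
  have [D hD DY] := hY.
  apply: (cdf_draws_to_first_good hD DY (q := fun k => q ^+ k)).
    move=> k; rewrite (prob_avoids_with _ _ V0 hD); do 3!f_equal.
    rewrite /q -hG rmorphB rmorph1 fmorph_div /= !ratr_nat natrB ?max_card//.
    by rewrite mulrBl divff// pnatr_eq0 -lt0n.
  exact: cvg_expr.
(* The number of good objects is written as a function of N alone, so that the
   factors form a sequence without choosing the set of good objects. *)
pose r (N j : nat) : R :=
  (N - Num.truncn (p * N%:R) - j)%:R / (N - j)%:R.
have cardE N (H : {set 'I_N}) : #|H|%:R = p * N%:R ->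
    Num.truncn (p * N%:R) = #|H|.
  by move=> <-; rewrite natrK.
have qE N : admissible p N -> q = (N - Num.truncn (p * N%:R))%:R / N%:R.
  move=> aN; have [H HE _] := hX N aN; have [N0 _] := aN.
  have HN : (#|H| <= N)%N by rewrite -[leqRHS]card_ord max_card.
  have HR : #|H|%:R = ratr p * N%:R :> R.
    by rewrite -(ratr_nat R #|H|) HE rmorphM /= ratr_nat.
  rewrite (cardE _ _ HE) natrB// HR /q rmorphB rmorph1.
  by rewrite mulrBl mulfK ?divff// pnatr_eq0 -lt0n.
have cdfX N : admissible p N -> cdf (X N) x = (1 - \prod_(j < n) r N j)%:E.
  move=> aN; have [H HE [D hD DX]] := hX N aN; have [N0 _] := aN.
  have H0 : (0 < #|H|)%N.
    by rewrite -(ltr0n rat) HE mulr_gt0// ltr0n.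
  apply: (cdf_draws_to_first_good hD DX (q := fun k => \prod_(j < k) r N j)).
    by move=> k; rewrite (prob_avoids_without _ H0 hD) card_ord /r (cardE _ _ HE).
  (* Once k > N the product contains the factor j = N, whose numerator is 0. *)
  apply: cvg_near_cst; exists N.+1 => // k /= Nk.
  by rewrite (bigD1 (Ordinal Nk)) //= /r subnAC subnn sub0n mul0r mul0r.
have cvg_r j : r N j @[N --> within (admissible p) \oo] --> q.
  have cvg_inv : N%:R^-1 @[N --> within (admissible p) \oo] --> (0 : R).
    apply: cvg_trans; first by apply: cvg_app; exact: cvg_within.
    by rewrite -cvg_shiftS; exact: cvg_harmonic.
  apply: cvg_zero; apply: norm_cvg0.
  apply: (@squeeze_cvgr _ _ _ _ (cst 0) (fun N => 2 * j%:R / N%:R)).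
  - near=> N; rewrite normr_ge0 /=.
    have aN : admissible p N by near: N; exact: withinT.
    have [H HE _] := hX N aN.
    have HN : (#|H| <= N)%N by rewrite -[leqRHS]card_ord max_card.
    rewrite -[_ N]/(r N j - q) [X in _ - X](qE _ aN) /r (cardE _ _ HE); apply: ratio_dist_le => //.
    near: N; apply: cvg_within; exact: nbhs_infty_gt.
  - exact: cvg_cst.
  - rewrite -[X in _ --> X](mulr0 (2 * j%:R)).
    by apply: cvgM; first exact: cvg_cst.
rewrite cdfY.
apply: cvg_trans; first apply: (near_eq_cvg (f := fun N =>
  (1 - \prod_(j < n) r N j)%:E)).
  near=> N; rewrite cdfX//.
  by near: N; exact: withinT.
apply: cvg_EFin; first exact: nearW.
apply: cvgB; first exact: cvg_cst.
have -> : q ^+ n = \prod_(j < n) q by rewrite prodr_const card_ord.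
by apply: cvg_big => [|i _]; [exact: mul_continuous|exact: cvg_r].
Unshelve. all: by end_near.
Qed.
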